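(* Let $r_\alpha, r_\beta, r_v, t_v, \sigma_B, \sigma_W > 0$ and $\overline{v}_T \in \mathbb{R}$. Suppose that $0 \le \lambda \le r_\beta \sigma_W^2$. Then for any $T > 0$ and any continuous functions $f_c, f_d, \overline{v} : [0,T] \to \mathbb{R}$, the terminal value problem $$ \begin{cases} \dot{\mu}_t = \frac{1}{r_\alpha}\mu_t^2 + \frac{1}{r_\beta}\eta_t^2 - 2\eta_t - r_v,\\ \dot{\eta}_t = \frac{1}{r_\alpha}\mu_t \eta_t + \frac{1}{r_\beta}\rho_t \eta_t - \rho_t - \frac{\lambda}{r_\beta \sigma_W^2}\eta_t f_c(t),\\ \dot{\rho}_t = \frac{1}{r_\alpha}\eta_t^2 + \frac{1}{r_\beta} \rho_t^2 - \frac{2\lambda}{r_\beta \sigma_W^2}\rho_t f_c(t) + \left(\frac{\lambda^2}{r_\beta \sigma_W^4} - \frac{\lambda}{\sigma_W^2}\right)f_c(t)^2,\\ \dot{\gamma}_t = \frac{1}{r_\alpha} \mu_t \gamma_t + \frac{1}{r_\beta}\eta_t \theta_t - \theta_t + r_v \overline{v}(t) - \frac{\lambda}{r_\beta \sigma_W^2}\eta_t f_d(t),\\ \dot{\theta}_t = \frac{1}{r_\alpha}\eta_t \gamma_t + \frac{1}{r_\beta}\rho_t \theta_t - \frac{\lambda}{r_\beta \sigma_W^2}\theta_t f_c(t) - \frac{\lambda}{r_\beta \sigma_W^2}f_d(t) \rho_t + \left(\frac{\lambda^2}{r_\beta \sigma_W^4} - \frac{\lambda}{\sigma_W^2}\right)f_c(t)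 f_d(t),\\ \dot{\xi}_t = \frac{1}{2r_\alpha}\gamma_t^2 + \frac{1}{2r_\beta}\theta_t^2 - \frac{1}{2}\sigma_B^2 \mu_t - \frac{1}{2}\sigma_W^2 \rho_t - \frac{\lambda}{r_\beta \sigma_W^2}f_d(t) \theta_t - \frac{r_v}{2}\overline{v}(t)^2 + \left(\frac{\lambda^2}{2 r_\beta \sigma_W^4} - \frac{\lambda}{2 \sigma_W^2}\right)f_d(t)^2, \end{cases} $$ with terminal conditions $\mu_T = t_v$, $\eta_T = 0$, $\rho_T = 0$, $\gamma_T = -t_v\overline{v}_T$, $\theta_T = 0$, $\xi_T = \frac{t_v}{2}\overline{v}_T^2$, has a unique global solution $(\mu,\eta,\rho,\gamma,\theta,\xi)$ on $[0,T]$.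
   Context: A dot denotes the derivative with respect to $t$, and $\mu,\eta,\rho,\gamma,\theta,\xi : [0,T]\to\mathbb{R}$ are the unknown functions. The symbol $t_v$ denotes a constant parameter (not a function of time). *)

(* Defs.v *)
From Stdlib Require Import Reals.
Open Scope R_scope.

(* Functions on [0,T] are represented by total functions R -> R; every notion
   below only looks at their values on [0,T]. *)
Definition Icc (a b : R) (t : R) : Prop := a <= t <= b.

Definition continuous_on_Icc (f : R -> R) (a b : R) : Prop :=
  forall t, Icc a b t -> continue_in f (Icc a b) t.

(* The derivative is taken relative to [a,b]: two-sided in the interior,
   one-sided at a and b. *)
Definition has_deriv_on_Icc (f f' : R -> R) (a b : R) : Prop :=
  forall t, Icc a b t -> D_in f f' (Icc a b) t.

Definition eq_on_Icc (f g : R -> R) (a b : R) : Prop :=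
  forall t, Icc a b t -> f t = g t.

Definition riccati_ode
    (r_a r_b r_v sigma_B sigma_W lambda T : R) (f_c f_d vbar : R -> R)
    (mu eta rho gamma theta xi : R -> R) : Prop :=
  has_deriv_on_Icc mu (fun t =>
      1 / r_a * mu t ^ 2 + 1 / r_b * eta t ^ 2 - 2 * eta t - r_v) 0 T
  /\ has_deriv_on_Icc eta (fun t =>
      1 / r_a * mu t * eta t + 1 / r_b * rho t * eta t - rho t
      - lambda / (r_b * sigma_W ^ 2) * eta t * f_c t) 0 T
  /\ has_deriv_on_Icc rho (fun t =>
      1 / r_a * eta t ^ 2 + 1 / r_b * rho t ^ 2
      - 2 * lambda / (r_b * sigma_W ^ 2) * rho t * f_c t
      + (lambda ^ 2 / (r_b * sigma_W ^ 4) - lambda / sigma_W ^ 2)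
        * f_c t ^ 2) 0 T
  /\ has_deriv_on_Icc gamma (fun t =>
      1 / r_a * mu t * gamma t + 1 / r_b * eta t * theta t - theta t
      + r_v * vbar t
      - lambda / (r_b * sigma_W ^ 2) * eta t * f_d t) 0 T
  /\ has_deriv_on_Icc theta (fun t =>
      1 / r_a * eta t * gamma t + 1 / r_b * rho t * theta t
      - lambda / (r_b * sigma_W ^ 2) * theta t * f_c t
      - lambda / (r_b * sigma_W ^ 2) * f_d t * rho t
      + (lambda ^ 2 / (r_b * sigma_W ^ 4) - lambda / sigma_W ^ 2)
        * f_c t * f_d t) 0 T
  /\ has_deriv_on_Icc xi (fun t =>
      1 / (2 * r_a) * gamma t ^ 2 + 1 / (2 * r_b) * theta t ^ 2
      - 1 / 2 * sigma_B ^ 2 * mu t - 1 / 2 * sigma_W ^ 2 * rho t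
      - lambda / (r_b * sigma_W ^ 2) * f_d t * theta t
      - r_v / 2 * vbar t ^ 2
      + (lambda ^ 2 / (2 * r_b * sigma_W ^ 4) - lambda / (2 * sigma_W ^ 2))
        * f_d t ^ 2) 0 T.

Definition terminal_conditions
    (t_v vbar_T T : R) (mu eta rho gamma theta xi : R -> R) : Prop :=
  mu T = t_v /\ eta T = 0 /\ rho T = 0
  /\ gamma T = - t_v * vbar_T /\ theta T = 0
  /\ xi T = t_v / 2 * vbar_T ^ 2.

Definition tvp_solution
    (r_a r_b r_v t_v sigma_B sigma_W vbar_T lambda T : R)
    (f_c f_d vbar : R -> R) (mu eta rho gamma theta xi : R -> R) : Prop :=
  riccati_ode r_a r_b r_v sigma_B sigma_W lambda T f_c f_d vbar
    mu eta rho gamma theta xi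
  /\ terminal_conditions t_v vbar_T T mu eta rho gamma theta xi.

(* Main.v *)
Require Import Defs.
From Stdlib Require Import Reals Lra List.
From Coquelicot Require Import Coquelicot.
Import ListNotations.
Open Scope R_scope.

(** The first three equations are closed and form a matrix Riccati equation.
    With [P] the symmetric matrix of rows [(mu, eta)] and [(eta, rho)], they say
      [P' = P D P - A^T P - P A - Q],  [P(T) = diag(t_v, 0)],
    where [D = diag(1/r_a, 1/r_b)], [A] has rows [(0, 0)] and [(1, g)],
    [Q = diag(r_v, w)], with [g = lambda f_c / (r_b sigma_W^2)] and
    [w = (lambda / sigma_W^2 - lambda^2 / (r_b sigma_W^4)) f_c^2].
    The condition [0 <= lambda <= r_b sigma_W^2] is exactly what makes [w >= 0],
    so that this is the Riccati equation of a linear-quadratic control problem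
    with nonnegative costs, and no blow-up occurs.

    Instead of continuing a local solution under a priori bounds, the equation
    is linearised: if [x' = A x - D y] and [y' = - A^T y - Q x] (the Hamiltonian
    system of the control problem) is solved by square matrices [X], [Y] with
    [X(T) = 1] and [Y(T) = P(T)], then [P = Y X^-1] solves the Riccati equation
    wherever [X] is invertible ([riccati_exists]).  [X] is invertible on all of
    [[0,T]]: along a solution, the scalar product [x . y] has derivative
    [- y . D y - x . Q x <= 0] and is nonnegative at [T], so that if [x] vanishes
    at some time [t0] then [x . y] is zero on [[t0,T]]; hence [y2 = x1 = 0] there,
    [x2] solves a scalar homogeneous equation with a zero at [t0], and [x(T) = 0]
    ([hamiltonian_position_nonvanishing]).  The symmetry of [P], needed since
    [eta] stands for both off-diagonal entries, is the conservation of the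
    symplectic form of two solutions.

    Given [mu, eta, rho], the equations of [gamma, theta] are linear, and the one
    of [xi] is a mere integration.  All that is needed from the theory of
    differential equations is thus the global solvability of linear systems
    ([linear_terminal_value_problem]), obtained from the Picard iteration.

    For uniqueness, the difference of two solutions of the whole system, which is
    quadratic, solves a homogeneous linear system whose continuous coefficients
    are built from the two solutions, and it vanishes at [T]
    ([linear_homogeneous_zero]).  A one-sided derivative at the end points of
    [[0,T]] is turned into a two-sided one by extending the function affinely
    ([has_deriv_on_Icc_extend]). *)

(** * Continuous functions on a compact interval *)

Definition clamp (a b t : R) : R := Rmax a (Rmin b t).

Lemma clamp_in a b t : a <= b -> Icc a b (clamp a b t).
Proof.
  intros Hab; unfold Icc, clamp, Rmax, Rmin.
  repeat destruct Rle_dec; lra.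
Qed.

Lemma clamp_id a b t : Icc a b t -> clamp a b t = t.
Proof.
  intros [H1 H2]; unfold clamp, Rmax, Rmin.
  repeat destruct Rle_dec; lra.
Qed.

Lemma clamp_contract a b s t : a <= b ->
  Rabs (clamp a b s - clamp a b t) <= Rabs (s - t).
Proof.
  intros Hab; unfold clamp, Rmax, Rmin.
  repeat destruct Rle_dec; unfold Rabs; repeat destruct Rcase_abs; lra.
Qed.

Lemma continuous_clamp f a b t : a <= b -> continuous_on_Icc f a b ->
  continuous (fun s => f (clamp a b s)) t.
Proof.
  intros Hab Hf.
  apply filterlim_locally; intros eps.
  destruct (Hf (clamp a b t) (clamp_in a b t Hab) eps (cond_pos eps))
    as (del & Hdel & H).
  exists (mkposreal del Hdel); intros s Hs.
  change (Rabs (f (clamp a b s) - f (clamp a b t)) < eps).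
  change (Rabs (s - t) < del) in Hs.
  destruct (Req_dec (clamp a b t) (clamp a b s)) as [E|E].
  - rewrite E, Rminus_diag, Rabs_R0; apply cond_pos.
  - apply (H (clamp a b s)); split.
    + split; [now apply clamp_in | exact E].
    + apply Rle_lt_trans with (2 := Hs), clamp_contract, Hab.
Qed.

Lemma continuous_on_Icc_bounded f a b : a <= b -> continuous_on_Icc f a b ->
  exists K, forall t, Icc a b t -> Rabs (f t) <= K.
Proof.
  intros Hab Hf.
  destruct (continuity_ab_maj (fun s => Rabs (f (clamp a b s))) a b Hab)
    as (m & Hm & _).
  { intros t _; apply continuity_pt_filterlim.
    apply (continuous_comp (fun s => f (clamp a b s)) Rabs).
    - now apply continuous_clamp.
    - apply continuous_Rabs. }
  exists (Rabs (f (clamp a b m))); intros t Ht.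
  specialize (Hm t Ht); simpl in Hm.
  now rewrite (clamp_id a b t Ht) in Hm.
Qed.

Lemma continuous_on_Icc_of_pt f a b :
  (forall t, Icc a b t -> continuous f t) -> continuous_on_Icc f a b.
Proof.
  intros Hf t Ht eps Heps.
  destruct (proj1 (filterlim_locally f (f t)) (Hf t Ht) (mkposreal eps Heps))
    as [del H].
  exists del; split; [apply cond_pos | intros s [_ Hs]; exact (H s Hs)].
Qed.

Lemma continuous_on_Icc_const c a b : continuous_on_Icc (fun _ => c) a b.
Proof. apply continuous_on_Icc_of_pt; intros; apply continuous_const. Qed.

Lemma continuous_on_Icc_plus f g a b :
  continuous_on_Icc f a b -> continuous_on_Icc g a b ->
  continuous_on_Icc (fun t => f t + g t) a b.
Proof. intros Hf Hg t Ht; exact (limit_plus f g _ _ _ _ (Hf t Ht) (Hg t Ht)). Qed.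

Lemma continuous_on_Icc_minus f g a b :
  continuous_on_Icc f a b -> continuous_on_Icc g a b ->
  continuous_on_Icc (fun t => f t - g t) a b.
Proof. intros Hf Hg t Ht; exact (limit_minus f g _ _ _ _ (Hf t Ht) (Hg t Ht)). Qed.

Lemma continuous_on_Icc_opp f a b :
  continuous_on_Icc f a b -> continuous_on_Icc (fun t => - f t) a b.
Proof. intros Hf t Ht; exact (limit_Ropp f _ _ _ (Hf t Ht)). Qed.

Lemma continuous_on_Icc_mult f g a b :
  continuous_on_Icc f a b -> continuous_on_Icc g a b ->
  continuous_on_Icc (fun t => f t * g t) a b.
Proof. intros Hf Hg t Ht; exact (limit_mul f g _ _ _ _ (Hf t Ht) (Hg t Ht)). Qed.

Lemma continuous_on_Icc_pow f n a b :
  continuous_on_Icc f a b -> continuous_on_Icc (fun t => f t ^ n) a b.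
Proof.
  intros Hf; induction n as [|n IH]; simpl.
  - apply continuous_on_Icc_const.
  - now apply continuous_on_Icc_mult.
Qed.

Ltac continuity_on :=
  repeat first
    [ assumption
    | apply continuous_on_Icc_const
    | apply continuous_on_Icc_plus
    | apply continuous_on_Icc_minus
    | apply continuous_on_Icc_opp
    | apply continuous_on_Icc_mult
    | apply continuous_on_Icc_pow ].

(** * Comparison of derivatives *)

Lemma derivative_le_0_decreasing f f' a b : a <= b ->
  (forall t, Icc a b t -> is_derive f t (f' t)) ->
  (forall t, Icc a b t -> f' t <= 0) -> f b <= f a.
Proof.
  intros Hab Hd Hn.
  destruct (MVT_gen f a b f') as (c & Hc & E);
    rewrite ?(Rmin_left a b Hab), ?(Rmax_right a b Hab) in *.
  - intros t Ht; apply Hd; unfold Icc; lra.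
  - intros t Ht; apply continuity_pt_filterlim, (ex_derive_continuous f).
    exists (f' t); now apply Hd.
  - specialize (Hn c Hc); nra.
Qed.

(** Both [h + d] and [h - d] are nonincreasing, hence at least as large at [a] as
    at [b].  This replaces integral estimates throughout. *)
Lemma derivative_comparison d d' h h' a b : a <= b ->
  (forall t, Icc a b t -> is_derive d t (d' t)) ->
  (forall t, Icc a b t -> is_derive h t (h' t)) ->
  (forall t, Icc a b t -> Rabs (d' t) <= - h' t) ->
  Rabs (d b) <= h b -> Rabs (d a) <= h a.
Proof.
  intros Hab Hd Hh Hle Hb.
  assert (H1 : h b + d b <= h a + d a).
  { apply (derivative_le_0_decreasing (fun t => h t + d t)
             (fun t => h' t + d' t) a b Hab).
    - intros t Ht; apply (is_derive_plus h d); auto.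
    - intros t Ht; specialize (Hle t Ht); apply Rabs_le_between in Hle; lra. }
  assert (H2 : h b - d b <= h a - d a).
  { apply (derivative_le_0_decreasing (fun t => h t - d t)
             (fun t => h' t - d' t) a b Hab).
    - intros t Ht; apply (is_derive_minus h d); auto.
    - intros t Ht; specialize (Hle t Ht); apply Rabs_le_between in Hle; lra. }
  apply Rabs_le_between in Hb; apply Rabs_le_between; lra.
Qed.

(** The exponential weight turns a Volterra operator with Lipschitz constant [L]
    into a contraction of ratio 1/2, over an interval of any length: the
    derivative of the [n+1]-st envelope is minus [L] times the [n]-th one. *)
Definition envelope (C L T : R) (n : nat) (t : R) : R :=
  C * (/ 2) ^ n * exp (2 * L * (T - t)).

Lemma is_derive_envelope C L T n t :
  is_derive (envelope C L T n) t (- (2 * L) * envelope C L T n t).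
Proof. unfold envelope; auto_derive; [trivial | unfold Rminus; ring]. Qed.

Lemma envelope_S C L T n t : 2 * envelope C L T (S n) t = envelope C L T n t.
Proof. unfold envelope; simpl; field. Qed.

Lemma envelope_ge_0 C L T n t : 0 <= C -> 0 <= envelope C L T n t.
Proof.
  intros HC; unfold envelope.
  apply Rmult_le_pos; [apply Rmult_le_pos; [exact HC|] |].
  - apply pow_le; lra.
  - left; apply exp_pos.
Qed.

Lemma envelope_0_ge C L T t : 0 <= C -> 0 <= L -> t <= T ->
  C <= envelope C L T 0 t.
Proof.
  intros HC HL Ht; unfold envelope; simpl.
  assert (0 <= 2 * L * (T - t)) by (apply Rmult_le_pos; lra).
  generalize (exp_ineq1_le (2 * L * (T - t))); nra.
Qed.

Lemma is_lim_seq_envelope C L T t :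
  is_lim_seq (fun n => envelope C L T n t) 0.
Proof.
  apply is_lim_seq_ext with (fun n => C * exp (2 * L * (T - t)) * (/ 2) ^ n).
  - intros n; unfold envelope; ring.
  - replace (Finite 0) with (Rbar_mult (C * exp (2 * L * (T - t))) 0)
      by (simpl; f_equal; ring).
    apply is_lim_seq_scal_l, is_lim_seq_geom.
    rewrite Rabs_right; lra.
Qed.

Lemma eq_of_envelope C L T t x y :
  (forall n, Rabs (x - y) <= envelope C L T n t) -> x = y.
Proof.
  intros H.
  enough (Rabs (x - y) <= 0).
  { generalize (Rabs_pos (x - y)); intros.
    destruct (Req_dec (x - y) 0) as [E|E]; [lra | apply Rabs_no_R0 in E; lra]. }
  apply (is_lim_seq_le (fun _ => Rabs (x - y)) (fun n => envelope C L T n t)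
           (Rabs (x - y)) 0 H).
  - apply is_lim_seq_const.
  - apply is_lim_seq_envelope.
Qed.

(** * The Picard iteration *)

(** The integrand is frozen beyond [T], so that the iterates are differentiable
    on the whole line, also at the terminal time, while the estimates are needed
    on the left of [T] only. *)
Fixpoint picard_iterate {I : Type} (F : R -> (I -> R) -> I -> R) (x0 : I -> R)
    (T : R) (n : nat) (t : R) (i : I) : R :=
  match n with
  | O => x0 i
  | S n => x0 i + RInt (fun s => F s (picard_iterate F x0 T n (Rmin s T)) i) T t
  end.

Lemma continuous_Rmin_r (T t : R) : continuous (fun s => Rmin s T) t.
Proof.
  apply filterlim_locally; intros eps; exists eps; intros s Hs.
  change (Rabs (s - t) < eps) in Hs.
  change (Rabs (Rmin s T - Rmin t T) < eps).
  revert Hs; unfold Rmin; repeat destruct Rle_dec;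
    unfold Rabs; repeat destruct Rcase_abs; lra.
Qed.

Lemma is_derive_primitive (c : R) (g : R -> R) (T t : R) :
  (forall s, continuous g s) ->
  is_derive (fun t => c + RInt g T t) t (g t).
Proof.
  intros Hg.
  replace (g t) with (plus 0 (g t)) by apply Rplus_0_l.
  apply (is_derive_plus (fun _ => c) (fun t => RInt g T t)).
  - exact (is_derive_const c t).
  - apply (is_derive_RInt g (fun t => RInt g T t) T t); [| apply Hg].
    apply filter_forall; intros s.
    apply (RInt_correct g), (ex_RInt_continuous g); intros; apply Hg.
Qed.

(** The estimates are uniform in the component [i], so that neither a norm nor the
    finiteness of the index type [I] is used.  The step between successive
    iterates is bounded by the envelopes, by [derivative_comparison]; their sum is
    geometric, so the iterates converge locally uniformly to a continuous [Z].
    The solution [X] is the Picard image of [Z]: it is differentiable everywhere,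
    and equal to [Z] up to time [T] because its distance to the iterates is also
    bounded by an envelope. *)
Lemma lipschitz_terminal_value_problem (I : Type) (F : R -> (I -> R) -> I -> R)
    (x0 : I -> R) (T L M : R) :
  0 < L ->
  (forall z : R -> I -> R, (forall i t, continuous (fun s => z s i) t) ->
     forall i t, continuous (fun s => F s (z s) i) t) ->
  (forall s u v delta, (forall j, Rabs (u j - v j) <= delta) ->
     forall i, Rabs (F s u i - F s v i) <= L * delta) ->
  (forall s i, Rabs (F s x0 i) <= M) ->
  exists X : R -> I -> R, (forall i, X T i = x0 i) /\
    forall i t, t <= T -> is_derive (fun s => X s i) t (F t (X t) i).
Proof.
  intros HL Hcont Hlip HM.
  assert (HC : forall i : I, 0 <= M / (2 * L)).
  { intros i; apply Rdiv_le_0_compat; [|lra].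
    apply Rle_trans with (2 := HM T i), Rabs_pos. }
  set (C := M / (2 * L)) in HC.
  pose (W := picard_iterate F x0 T); pose (h := envelope C L T).
  assert (HWc : forall n i t, continuous (fun s => W n s i) t).
  { intros n; induction n as [|n IH]; intros i t.
    - apply (continuous_const (x0 i)).
    - apply (ex_derive_continuous (fun s => W (S n) s i)).
      eexists; apply (is_derive_primitive (x0 i)); intros s.
      apply (Hcont (fun s => W n (Rmin s T))); intros j r.
      apply (continuous_comp (fun s => Rmin s T) (fun s => W n s j)).
      + apply continuous_Rmin_r.
      + apply IH. }
  assert (HWFc : forall n i t,
    continuous (fun s => F s (W n (Rmin s T)) i) t).
  { intros n; apply (Hcont (fun s => W n (Rmin s T))); intros j r.
    apply (continuous_comp (fun s => Rmin s T) (fun s => W n s j)).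
    + apply continuous_Rmin_r.
    + apply HWc. }
  assert (HWd : forall n i t,
    is_derive (fun s => W (S n) s i) t (F t (W n (Rmin t T)) i)).
  { intros n i t; apply (is_derive_primitive (x0 i)), HWFc. }
  assert (HWT : forall n i, W n T i = x0 i).
  { intros [|n] i; [reflexivity|]; unfold W; simpl.
    rewrite RInt_point; apply Rplus_0_r. }
  (* [C] is chosen so that the 0-th envelope dominates the first step. *)
  assert (Hstep : forall n t, t <= T ->
    forall i, Rabs (W (S n) t i - W n t i) <= h n t).
  { intros n; induction n as [|n IH]; intros t Ht i.
    - apply (derivative_comparison (fun s => W 1%nat s i - W O s i)
        (fun s => minus (F s (W O (Rmin s T)) i) 0) (h O)
        (fun s => - (2 * L) * h O s) t T Ht).
      + intros s _; apply (is_derive_minus (fun s => W 1%nat s i)).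
        * apply HWd.
        * apply (is_derive_const (x0 i)).
      + intros s _; apply is_derive_envelope.
      + intros s [_ Hs]; unfold minus; simpl.
        change (Rabs (F s x0 i + - 0) <= - (- (2 * L) * h O s)).
        rewrite Ropp_0, Rplus_0_r.
        apply Rle_trans with (1 := HM s i).
        replace M with (2 * L * C) by (unfold C; field; lra).
        assert (C <= h O s)
          by (apply envelope_0_ge; [apply HC, i | lra | exact Hs]).
        nra.
      + rewrite !HWT, Rminus_diag, Rabs_R0; apply envelope_ge_0, HC, i.
    - apply (derivative_comparison (fun s => W (S (S n)) s i - W (S n) s i)
        (fun s => F s (W (S n) (Rmin s T)) i - F s (W n (Rmin s T)) i) (h (S n))
        (fun s => - (2 * L) * h (S n) s) t T Ht).
      + intros s _.
        apply (is_derive_minus (fun s => W (S (S n)) s i)); apply HWd.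
      + intros s _; apply is_derive_envelope.
      + intros s [_ Hs]; rewrite (Rmin_left s T Hs).
        replace (- (- (2 * L) * h (S n) s)) with (L * h n s)
          by (unfold h; rewrite <- envelope_S; ring).
        apply Hlip; intros j; apply IH, Hs.
      + rewrite !HWT, Rminus_diag, Rabs_R0; apply envelope_ge_0, HC, i. }
  assert (Htail : forall n k t i, t <= T ->
    Rabs (W (n + k)%nat t i - W n t i) <= 2 * h n t - 2 * h (n + k)%nat t).
  { intros n k t i Ht; induction k as [|k IH].
    - rewrite Nat.add_0_r, !Rminus_diag, Rabs_R0; lra.
    - replace (n + S k)%nat with (S (n + k)) by apply plus_n_Sm.
      assert (E : 2 * h (S (n + k)) t = h (n + k)%nat t) by apply envelope_S.
      generalize (Hstep (n + k)%nat t Ht i); intros H1.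
      apply Rabs_le_between in H1, IH; apply Rabs_le_between; lra. }
  pose (Z := fun t i => real (Lim_seq (fun n => W n (Rmin t T) i))).
  assert (HZ : forall n t i, t <= T -> Rabs (Z t i - W n t i) <= 2 * h n t).
  { intros n t i Ht; unfold Z; rewrite (Rmin_left t T Ht).
    assert (Hlim : is_lim_seq (fun m => W m t i)
      (Finite (real (Lim_seq (fun m => W m t i))))).
    { apply Lim_seq_correct', ex_lim_seq_cauchy_corr; intros eps.
      destruct (proj1 (is_lim_seq_Reals _ _) (is_lim_seq_envelope C L T t)
        (eps / 4)) as [N HN]; [generalize (cond_pos eps); lra|].
      specialize (HN N (le_n N)); unfold Rdist in HN.
      rewrite Rminus_0_r in HN; apply Rabs_lt_between in HN.
      exists N; intros p q Hp Hq.
      generalize (Htail N (p - N)%nat t i Ht) (Htail N (q - N)%nat t i Ht).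
      rewrite !(Nat.add_comm N), !Nat.sub_add by assumption; intros H1 H2.
      generalize (envelope_ge_0 C L T p t (HC i))
        (envelope_ge_0 C L T q t (HC i)); intros H3 H4.
      apply Rabs_le_between in H1, H2; fold h in HN, H3, H4.
      apply Rabs_lt_between; lra. }
    apply (is_lim_seq_le (fun k => Rabs (W (k + n)%nat t i - W n t i))
      (fun _ => 2 * h n t)
      (Finite (Rabs (real (Lim_seq (fun m => W m t i)) - W n t i)))
      (Finite (2 * h n t))).
    - intros k; rewrite Nat.add_comm.
      generalize (Htail n k t i Ht) (envelope_ge_0 C L T (n + k) t (HC i)).
      fold h; lra.
    - apply (is_lim_seq_abs _ (Finite _)).
      apply (is_lim_seq_minus' (fun k => W (k + n)%nat t i)).
      + exact (proj1 (is_lim_seq_incr_n (fun m => W m t i) n _) Hlim).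
      + apply is_lim_seq_const.
    - apply is_lim_seq_const. }
  (* Uniformity of the convergence near [t]: on the right of [t - 1] the
     envelopes are bounded by their value at [t - 1]. *)
  assert (HZc : forall i t, continuous (fun s => Z s i) t).
  { intros i t; apply filterlim_locally; intros eps.
    destruct (proj1 (is_lim_seq_Reals _ _)
      (is_lim_seq_envelope C L T (Rmin (t - 1) T)) (eps / 8)) as [N HN];
      [generalize (cond_pos eps); lra|].
    specialize (HN N (le_n N)); unfold Rdist in HN.
    rewrite Rminus_0_r in HN; apply Rabs_lt_between in HN.
    assert (Hnear : forall s, t - 1 <= s ->
      Rabs (Z s i - W N (Rmin s T) i) <= eps / 4).
    { intros s Hs.
      replace (Z s i) with (Z (Rmin s T) i)
        by (unfold Z; rewrite (Rmin_left (Rmin s T) T (Rmin_r s T)); easy).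
      apply Rle_trans with (1 := HZ N (Rmin s T) i (Rmin_r s T)).
      apply Rle_trans with (2 * h N (Rmin (t - 1) T)); [|unfold h; lra].
      apply Rmult_le_compat_l; [lra|]; unfold h, envelope.
      apply Rmult_le_compat_l.
      - apply Rmult_le_pos; [apply HC, i | apply pow_le; lra].
      - assert (Rmin (t - 1) T <= Rmin s T) as [H|H]
          by (apply Rle_min_compat_r; exact Hs).
        + left; apply exp_increasing, Rmult_lt_compat_l; lra.
        + rewrite H; lra. }
    assert (Hc : continuous (fun s => W N (Rmin s T) i) t).
    { apply (continuous_comp (fun s => Rmin s T) (fun s => W N s i)).
      + apply continuous_Rmin_r.
      + apply HWc. }
    assert (Heps : 0 < eps / 4) by (generalize (cond_pos eps); lra).
    destruct (proj1 (filterlim_locally _ _) Hc (mkposreal _ Heps)) as [del Hdel].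
    assert (Hmin : 0 < Rmin del 1)
      by (apply Rmin_pos; [apply cond_pos | lra]).
    exists (mkposreal _ Hmin); intros s Hs.
    change (Rabs (s - t) < Rmin del 1) in Hs.
    change (Rabs (Z s i - Z t i) < eps).
    generalize (Rmin_l del 1) (Rmin_r del 1); intros Hl Hr.
    assert (Hs1 : t - 1 <= s) by (apply Rabs_lt_between in Hs; lra).
    assert (Ht1 : t - 1 <= t) by lra.
    assert (Hd : Rabs (W N (Rmin s T) i - W N (Rmin t T) i) < eps / 4)
      by (apply Hdel; change (Rabs (s - t) < del); lra).
    generalize (Hnear s Hs1) (Hnear t Ht1); intros H1 H2.
    apply Rabs_le_between in H1, H2; apply Rabs_lt_between in Hd.
    apply Rabs_lt_between; lra. }
  pose (X := fun t i => x0 i + RInt (fun s => F s (Z s) i) T t).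
  assert (HXd : forall i t, is_derive (fun s => X s i) t (F t (Z t) i)).
  { intros i t; apply is_derive_primitive, Hcont, HZc. }
  assert (HXT : forall i, X T i = x0 i).
  { intros i; unfold X; rewrite RInt_point; apply Rplus_0_r. }
  assert (HXZ : forall i t, t <= T -> X t i = Z t i).
  { intros i t Ht; apply (eq_of_envelope (3 * C) L T t); intros n.
    assert (H1 : Rabs (X t i - W (S n) t i) <= 2 * h n t).
    { apply (derivative_comparison (fun s => X s i - W (S n) s i)
        (fun s => F s (Z s) i - F s (W n (Rmin s T)) i) (fun s => 2 * h n s)
        (fun s => 2 * (- (2 * L) * h n s)) t T Ht).
      + intros s _; apply (is_derive_minus (fun s => X s i)); auto.
      + intros s _; apply (is_derive_scal (h n)), is_derive_envelope.
      + intros s [_ Hs]; rewrite (Rmin_left s T Hs).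
        apply Rle_trans with (L * (2 * h n s)).
        * apply Hlip; intros j; apply HZ, Hs.
        * generalize (envelope_ge_0 C L T n s (HC i)); fold h; nra.
      + rewrite HXT, HWT, Rminus_diag, Rabs_R0.
        generalize (envelope_ge_0 C L T n T (HC i)); fold h; lra. }
    generalize (HZ (S n) t i Ht); intros H2.
    unfold h in H2; rewrite envelope_S in H2; fold h in H2.
    replace (envelope (3 * C) L T n t) with (3 * h n t)
      by (unfold h, envelope; ring).
    apply Rabs_le_between in H1, H2; apply Rabs_le_between; lra. }
  (* [X t] and [Z t] agree pointwise; the Lipschitz condition with [delta = 0]
     makes [F] respect pointwise equality. *)
  exists X; split; [exact HXT|]; intros i t Ht.
  replace (F t (X t) i) with (F t (Z t) i); [apply HXd|].
  assert (H0 : Rabs (F t (Z t) i - F t (X t) i) <= L * 0).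
  { apply Hlip; intros j; rewrite (HXZ j t Ht), Rminus_diag, Rabs_R0; lra. }
  apply Rabs_le_between in H0; lra.
Qed.

(** * Linear systems *)

(** [l] is meant to enumerate a finite index type [I]. *)
Definition lincomb {I : Type} (l : list I) (a u : I -> R) : R :=
  fold_right (fun j s => a j * u j + s) 0 l.

Lemma lincomb_minus I (l : list I) a u v :
  lincomb l a u - lincomb l a v = lincomb l a (fun j => u j - v j).
Proof.
  unfold lincomb; induction l as [|j l IH]; simpl; [ring|].
  rewrite <- IH; ring.
Qed.

Lemma lincomb_bound I (l : list I) a u K delta : 0 <= K ->
  (forall j, Rabs (a j) <= K) -> (forall j, Rabs (u j) <= delta) ->
  Rabs (lincomb l a u) <= INR (length l) * K * delta.
Proof.
  intros HK Ha Hu; induction l as [|j l IH].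
  - simpl; rewrite Rabs_R0; lra.
  - change (lincomb (j :: l) a u) with (a j * u j + lincomb l a u).
    change (length (j :: l)) with (S (length l)); rewrite S_INR.
    apply Rle_trans with (1 := Rabs_triang _ _).
    rewrite Rabs_mult.
    assert (Rabs (a j) * Rabs (u j) <= K * delta)
      by (apply Rmult_le_compat; auto using Rabs_pos).
    lra.
Qed.

Lemma continuous_lincomb I (l : list I) (a u : I -> R -> R) t :
  (forall j, continuous (a j) t) -> (forall j, continuous (u j) t) ->
  continuous (fun s => lincomb l (fun j => a j s) (fun j => u j s)) t.
Proof.
  intros Ha Hu; induction l as [|j l IH].
  - apply continuous_const.
  - apply (continuous_plus (fun s => a j s * u j s)); [|exact IH].
    now apply (continuous_mult (a j) (u j)).
Qed.

Lemma finite_bound I (l : list I) (P : I -> R -> Prop) :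
  (forall i, In i l) ->
  (forall i K K', K <= K' -> P i K -> P i K') ->
  (forall i, exists K, P i K) -> exists K, 0 <= K /\ forall i, P i K.
Proof.
  intros Hl Hmono HP.
  enough (exists K, 0 <= K /\ forall i, In i l -> P i K) as (K & HK & H)
    by (exists K; auto).
  clear Hl; induction l as [|i l (K & HK & IH)].
  - exists 0; split; [lra | intros i []].
  - destruct (HP i) as [K' HK']; exists (Rmax K K'); split.
    + apply Rle_trans with (1 := HK), Rmax_l.
    + intros j [<-|Hj].
      * apply Hmono with (2 := HK'), Rmax_r.
      * apply Hmono with (2 := IH j Hj), Rmax_l.
Qed.

Lemma family_bounded I (l : list I) (f : I -> R -> R) a b :
  (forall i, In i l) -> a <= b -> (forall i, continuous_on_Icc (f i) a b) ->
  exists K, 0 <= K /\ forall i t, Icc a b t -> Rabs (f i t) <= K.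
Proof.
  intros Hl Hab Hf.
  apply (finite_bound I l (fun i K => forall t, Icc a b t -> Rabs (f i t) <= K)).
  - exact Hl.
  - intros i K K' HK H t Ht; apply Rle_trans with (2 := HK); auto.
  - intros i; now apply continuous_on_Icc_bounded.
Qed.

Lemma matrix_bounded I (l : list I) (A : I -> I -> R -> R) a b :
  (forall i, In i l) -> a <= b -> (forall i j, continuous_on_Icc (A i j) a b) ->
  exists K, 0 <= K /\ forall i j t, Icc a b t -> Rabs (A i j t) <= K.
Proof.
  intros Hl Hab HA.
  apply (finite_bound I l
    (fun i K => forall j t, Icc a b t -> Rabs (A i j t) <= K)).
  - exact Hl.
  - intros i K K' HK H j t Ht; apply Rle_trans with (2 := HK); auto.
  - intros i; destruct (family_bounded I l (A i) a b Hl Hab (HA i)) as (K & _ & HK).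
    now exists K.
Qed.

(** A linear system with continuous coefficients is globally Lipschitz once the
    coefficients are made bounded on the whole line, which precomposition with
    [clamp] does without changing them on [[a,T]]. *)
Lemma linear_terminal_value_problem I (l : list I) (A : I -> I -> R -> R)
    (b : I -> R -> R) (x0 : I -> R) (a T : R) :
  (forall i, In i l) -> a <= T ->
  (forall i j, continuous_on_Icc (A i j) a T) ->
  (forall i, continuous_on_Icc (b i) a T) ->
  exists X : I -> R -> R, (forall i, X i T = x0 i) /\
    forall i t, Icc a T t ->
      is_derive (X i) t (lincomb l (fun j => A i j t) (fun j => X j t) + b i t).
Proof.
  intros Hl HaT HA Hb.
  destruct (matrix_bounded I l A a T Hl HaT HA) as (K & HK & HAK).
  destruct (family_bounded I l b a T Hl HaT Hb) as (Kb & HKb & HbK).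
  destruct (finite_bound I l (fun i k => Rabs (x0 i) <= k)) as (k0 & Hk0 & Hx0).
  { exact Hl. }
  { intros; lra. }
  { intros i; exists (Rabs (x0 i)); lra. }
  pose (c := clamp a T).
  pose (F := fun s u i => lincomb l (fun j => A i j (c s)) u + b i (c s)).
  assert (Hc : forall s, Icc a T (c s)) by (intros s; apply clamp_in, HaT).
  pose (L := INR (length l) * K).
  assert (HL : 0 <= L) by (apply Rmult_le_pos; [apply pos_INR | exact HK]).
  destruct (lipschitz_terminal_value_problem I F x0 T (L + 1) (L * k0 + Kb))
    as (X & HXT & HX).
  - lra.
  - intros z Hz i t; unfold F.
    apply (continuous_plus
      (fun s => lincomb l (fun j => A i j (c s)) (fun j => z s j))).
    + apply (continuous_lincomb I l (fun j s => A i j (c s)) (fun j s => z s j)).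
      * intros j; now apply (continuous_clamp (A i j)).
      * intros j; apply Hz.
    + now apply (continuous_clamp (b i)).
  - intros s u v delta Huv i; unfold F.
    replace (_ - _) with (lincomb l (fun j => A i j (c s)) u
      - lincomb l (fun j => A i j (c s)) v) by ring.
    rewrite lincomb_minus.
    apply Rle_trans with (L * delta).
    + apply lincomb_bound; auto.
    + generalize (Rle_trans _ _ _ (Rabs_pos _) (Huv i)); nra.
  - intros s i; unfold F.
    apply Rle_trans with (1 := Rabs_triang _ _), Rplus_le_compat.
    + apply lincomb_bound; auto.
    + auto.
  - exists (fun i t => X t i); split; [exact HXT|].
    intros i t Ht; generalize (HX i t (proj2 Ht)); unfold F, c.
    now rewrite (clamp_id a T t Ht).
Qed.

Lemma continuous_on_Icc_derive f f' a b :
  (forall t, Icc a b t -> is_derive f t (f' t)) -> continuous_on_Icc f a b.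
Proof.
  intros Hf; apply continuous_on_Icc_of_pt; intros t Ht.
  apply (ex_derive_continuous f); eexists; now apply Hf.
Qed.

(** Iterating the argument that gives Picard's estimate, a bound by one envelope
    improves to a bound by the next, so the solution is below all of them. *)
Lemma linear_homogeneous_zero I (l : list I) (A : I -> I -> R -> R)
    (d : I -> R -> R) (a T : R) :
  (forall i, In i l) ->
  (forall i j, continuous_on_Icc (A i j) a T) ->
  (forall i t, Icc a T t ->
     is_derive (d i) t (lincomb l (fun j => A i j t) (fun j => d j t))) ->
  (forall i, d i T = 0) ->
  forall i t, Icc a T t -> d i t = 0.
Proof.
  intros Hl HA Hd HT i0 t0 Ht0.
  assert (HaT : a <= T) by (unfold Icc in Ht0; lra).
  destruct (matrix_bounded I l A a T Hl HaT HA) as (K & HK & HAK).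
  destruct (family_bounded I l d a T Hl HaT) as (C & HC & HdC).
  { intros i; eapply continuous_on_Icc_derive, Hd. }
  pose (L := INR (length l) * K).
  assert (HL : 0 <= L) by (apply Rmult_le_pos; [apply pos_INR | exact HK]).
  apply (eq_of_envelope C L T t0); intros n; rewrite Rminus_0_r.
  revert i0 t0 Ht0; induction n as [|n IH]; intros i t Ht.
  - apply Rle_trans with (1 := HdC i t Ht), envelope_0_ge; auto; apply Ht.
  - apply (derivative_comparison (d i)
      (fun s => lincomb l (fun j => A i j s) (fun j => d j s))
      (envelope C L T (S n)) (fun s => - (2 * L) * envelope C L T (S n) s) t T).
    + apply Ht.
    + intros s Hs; apply Hd; unfold Icc in *; lra.
    + intros s _; apply is_derive_envelope.
    + intros s Hs.
      assert (Hs' : Icc a T s) by (unfold Icc in *; lra).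
      replace (- (- (2 * L) * envelope C L T (S n) s))
        with (L * envelope C L T n s) by (rewrite <- envelope_S; ring).
      apply lincomb_bound; auto.
    + rewrite HT, Rabs_R0; apply envelope_ge_0, HC.
Qed.

(** * One-sided and two-sided derivatives *)

Lemma has_deriv_on_Icc_of_is_derive f f' a b :
  (forall t, Icc a b t -> is_derive f t (f' t)) -> has_deriv_on_Icc f f' a b.
Proof.
  intros Hf t Ht eps Heps.
  destruct (proj1 (is_derive_Reals _ _ _) (Hf t Ht) eps Heps) as [del H].
  exists del; split; [apply cond_pos|]; intros s [[_ Hst] Hs].
  specialize (H (s - t) ltac:(intros E; apply Hst; lra) Hs).
  now rewrite Rplus_minus in H.
Qed.

(** Continuing the function beyond each end point by its tangent there makes the
    relative derivative an ordinary one, so that the usual calculus applies up to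
    the boundary. *)
Lemma has_deriv_on_Icc_extend f f' a b : a < b -> has_deriv_on_Icc f f' a b ->
  exists g, eq_on_Icc f g a b /\
    forall t, Icc a b t -> is_derive g t (f' t).
Proof.
  intros Hab Hf.
  pose (g := fun s => f (clamp a b s)
                      + f' a * Rmin (s - a) 0 + f' b * Rmax (s - b) 0).
  assert (Hg : forall t, Icc a b t -> g t = f t).
  { intros t Ht; unfold g; rewrite (clamp_id a b t Ht).
    destruct Ht as [H1 H2].
    rewrite Rmin_right, Rmax_right by lra; ring. }
  exists g; split; [intros t Ht; symmetry; now apply Hg|].
  intros t Ht; apply is_derive_Reals; intros eps Heps.
  destruct (Hf t Ht eps Heps) as (del & Hdel & H).
  (* Within distance [r] of [t], the interval can be left only through the end
     point that is [t] itself, where the extension is exactly affine. *)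
  assert (exists r, 0 < r /\ (forall s, s < a -> Rabs (s - t) < r -> t = a) /\
    (forall s, b < s -> Rabs (s - t) < r -> t = b)) as (r & Hr & Hra & Hrb).
  { destruct Ht as [H1 H2].
    destruct (Req_dec t a) as [Ea|Ea]; [|destruct (Req_dec t b) as [Eb|Eb]].
    - exists (b - a); split; [lra|]; split; intros s Hs Hd;
      apply Rabs_lt_between in Hd; lra.
    - exists (b - a); split; [lra|]; split; intros s Hs Hd;
      apply Rabs_lt_between in Hd; lra.
    - exists (Rmin (t - a) (b - t)); split; [apply Rmin_pos; lra|].
      generalize (Rmin_l (t - a) (b - t)) (Rmin_r (t - a) (b - t)); intros.
      split; intros s Hs Hd; apply Rabs_lt_between in Hd; lra. }
  assert (Hmin : 0 < Rmin del r) by (apply Rmin_pos; lra).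
  exists (mkposreal _ Hmin); intros h Hh Hhd; simpl in Hhd.
  generalize (Rmin_l del r) (Rmin_r del r); intros Hl Hr'.
  assert (Ehr : Rabs (t + h - t) < r) by (replace (t + h - t) with h by ring; lra).
  rewrite (Hg t Ht).
  destruct (Rlt_le_dec (t + h) a) as [Ha|Ha];
    [|destruct (Rlt_le_dec b (t + h)) as [Hb|Hb]].
  - assert (E := Hra _ Ha Ehr); subst t.
    replace (g (a + h)) with (f a + f' a * h).
    + replace (_ - _) with 0 by (field; exact Hh); now rewrite Rabs_R0.
    + unfold g, clamp; rewrite (Rmin_right b (a + h)) by lra.
      rewrite (Rmax_left a), Rmin_left, (Rmax_right _ 0) by lra; ring.
  - assert (E := Hrb _ Hb Ehr); subst t.
    replace (g (b + h)) with (f b + f' b * h).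
    + replace (_ - _) with 0 by (field; exact Hh); now rewrite Rabs_R0.
    + unfold g, clamp; rewrite (Rmin_left b (b + h)) by lra.
      rewrite (Rmax_right a), Rmin_right, (Rmax_left _ 0) by lra; ring.
  - rewrite Hg by (split; lra).
    specialize (H (t + h)); simpl in H; unfold Rdist in H.
    replace (t + h - t) with h in H by ring.
    apply H; repeat split; try lra.
Qed.

(** * The Hamiltonian system *)

(** The sum, difference, product and quotient rules in terms of the operations of
    [R], so that the resulting equations are within reach of [ring] and [field]. *)
Lemma is_derive_Rplus (f g : R -> R) (t df dg : R) :
  is_derive f t df -> is_derive g t dg ->
  is_derive (fun s => f s + g s) t (df + dg).
Proof. intros; now apply (is_derive_plus f g). Qed.

Lemma is_derive_Rminus (f g : R -> R) (t df dg : R) :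
  is_derive f t df -> is_derive g t dg ->
  is_derive (fun s => f s - g s) t (df - dg).
Proof. intros; now apply (is_derive_minus f g). Qed.

Lemma is_derive_Rmult (f g : R -> R) (t df dg : R) :
  is_derive f t df -> is_derive g t dg ->
  is_derive (fun s => f s * g s) t (df * g t + f t * dg).
Proof. intros; apply (is_derive_mult f g); auto using Rmult_comm. Qed.

Lemma is_derive_eq (f : R -> R) (t df df' : R) :
  is_derive f t df' -> df' = df -> is_derive f t df.
Proof. intros H E; now rewrite <- E. Qed.

(** The rule is chosen by the syntax of the function, because an atomic function
    unifies with the pattern of a rule only after costly or endless unfolding. *)
Ltac derive_step tac :=
  cbv beta;
  lazymatch goal with
  | |- is_derive (fun s => _ + _) _ _ => apply is_derive_Rplus
  | |- is_derive (fun s => _ - _) _ _ => apply is_derive_Rminus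
  | |- is_derive (fun s => _ * _) _ _ => apply is_derive_Rmult
  | |- is_derive (fun _ => ?c) _ _ => apply (is_derive_const c)
  | _ => solve [tac]
  end.

Ltac derive_with tac := eapply is_derive_eq; [repeat derive_step tac |].

(** Position [(x1, x2)] and adjoint state [(y1, y2)]. *)
Inductive coord := X1 | X2 | Y1 | Y2.

Definition hamiltonian_field (p q r g w : R) (z : coord -> R) (i : coord) : R :=
  match i with
  | X1 => - p * z Y1
  | X2 => z X1 + g * z X2 - q * z Y2
  | Y1 => - z Y2 - r * z X1
  | Y2 => - g * z Y2 - w * z X2
  end.

Definition hamiltonian_solution (p q r T : R) (g w : R -> R)
    (z : coord -> R -> R) : Prop :=
  forall i t, Icc 0 T t ->
    is_derive (z i) t (hamiltonian_field p q r (g t) (w t) (fun j => z j t) i).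

Lemma hamiltonian_solution_exists p q r T g w (z0 : coord -> R) : 0 <= T ->
  continuous_on_Icc g 0 T -> continuous_on_Icc w 0 T ->
  exists z, (forall i, z i T = z0 i) /\ hamiltonian_solution p q r T g w z.
Proof.
  intros HT Hg Hw.
  destruct (linear_terminal_value_problem coord [X1; X2; Y1; Y2]
    (fun i j t => match i, j with
                  | X1, Y1 => - p
                  | X2, X1 => 1 | X2, X2 => g t | X2, Y2 => - q
                  | Y1, Y2 => - 1 | Y1, X1 => - r
                  | Y2, Y2 => - g t | Y2, X2 => - w t
                  | _, _ => 0
                  end) (fun _ _ => 0) z0 0 T) as (z & HzT & Hz).
  - intros []; simpl; tauto.
  - exact HT.
  - intros [] []; continuity_on.
  - intros i; continuity_on.
  - exists z; split; [exact HzT|]; intros i t Ht.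
    apply is_derive_eq with (1 := Hz i t Ht).
    destruct i; simpl; ring.
Qed.

Lemma hamiltonian_solution_lincomb p q r T g w z z' a b :
  hamiltonian_solution p q r T g w z -> hamiltonian_solution p q r T g w z' ->
  hamiltonian_solution p q r T g w (fun i t => a * z i t + b * z' i t).
Proof.
  intros Hz Hz' i t Ht; generalize (Hz i t Ht) (Hz' i t Ht); intros H H'.
  derive_with eassumption.
  destruct i; simpl; unfold zero; simpl; ring.
Qed.

Ltac derive_solution Hz :=
  (* [idtac] delays the matching until the tactic runs on a goal. *)
  idtac;
  lazymatch type of Hz with
  | hamiltonian_solution _ _ _ _ _ _ ?z =>
      lazymatch goal with
      | |- is_derive (z ?i) ?t _ => apply (Hz i t); assumption
      | |- is_derive (fun s => z ?i s) ?t _ => apply (Hz i t); assumption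
      end
  end.

(** The contributions of [A] and [A^T] cancel in the derivative of [x . y]. *)
Lemma hamiltonian_energy_derive p q r T g w z t :
  hamiltonian_solution p q r T g w z -> Icc 0 T t ->
  is_derive (fun s => z X1 s * z Y1 s + z X2 s * z Y2 s) t
    (- (p * z Y1 t ^ 2 + q * z Y2 t ^ 2 + r * z X1 t ^ 2 + w t * z X2 t ^ 2)).
Proof.
  intros Hz Ht.
  derive_with ltac:(derive_solution Hz).
  simpl; ring.
Qed.

(** With [y(T) = diag(tv, 0) x(T)], the energy [E = x . y] is nonincreasing and
    nonnegative at [T]; where [x] vanishes, [E] is zero, hence it stays zero until
    [T].  Then [x1(T) = 0] because [tv > 0], and [E' = 0] kills [x1] and [y2], which
    reduces the equation of [x2] to [x2' = g x2] with [x2(t0) = 0]. *)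
Lemma hamiltonian_position_nonvanishing p q r T g w tv z t0 :
  0 < p -> 0 < q -> 0 < r -> 0 < tv ->
  continuous_on_Icc g 0 T -> (forall t, Icc 0 T t -> 0 <= w t) ->
  hamiltonian_solution p q r T g w z ->
  z Y1 T = tv * z X1 T -> z Y2 T = 0 ->
  Icc 0 T t0 -> z X1 t0 = 0 -> z X2 t0 = 0 -> z X1 T = 0 /\ z X2 T = 0.
Proof.
  intros Hp Hq Hr Htv Hg Hw Hz HY1 HY2 Ht0 H1 H2.
  pose (E := fun s => z X1 s * z Y1 s + z X2 s * z Y2 s).
  assert (Hsub : forall a b, Icc 0 T a -> Icc 0 T b ->
    forall t, Icc a b t -> Icc 0 T t) by (unfold Icc; intros; lra).
  assert (HTT : Icc 0 T T) by (unfold Icc in *; lra).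
  assert (Hle : forall t, Icc 0 T t -> 0 <= p * z Y1 t ^ 2 /\
    0 <= q * z Y2 t ^ 2 /\ 0 <= r * z X1 t ^ 2 /\ 0 <= w t * z X2 t ^ 2).
  { intros t Ht; specialize (Hw t Ht).
    repeat split; apply Rmult_le_pos; auto using pow2_ge_0; lra. }
  assert (Hdec : forall a b, Icc 0 T a -> Icc 0 T b -> a <= b -> E b <= E a).
  { intros a b Ha Hb Hab.
    eapply derivative_le_0_decreasing with (1 := Hab).
    - intros t Ht; eapply hamiltonian_energy_derive; eauto.
    - intros t Ht; simpl; specialize (Hle t (Hsub a b Ha Hb t Ht)); lra. }
  assert (HET : E T = tv * z X1 T ^ 2) by (unfold E; rewrite HY1, HY2; ring).
  assert (HE0 : E t0 = 0) by (unfold E; rewrite H1, H2; ring).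
  assert (HE : forall t, Icc t0 T t -> E t = 0).
  { intros t Ht; assert (Ht' := Hsub t0 T Ht0 HTT t Ht).
    generalize (Hdec t0 t Ht0 Ht' (proj1 Ht)) (Hdec t T Ht' HTT (proj2 Ht)).
    generalize (pow2_ge_0 (z X1 T)); nra. }
  assert (HX1 : z X1 T = 0).
  { rewrite HE in HET by (unfold Icc in *; lra).
    apply Rsqr_0_uniq; unfold Rsqr; nra. }
  split; [exact HX1|].
  assert (Hvan : forall t, t0 < t < T -> z X1 t = 0 /\ z Y2 t = 0).
  { intros t Ht; assert (Ht' : Icc 0 T t) by (unfold Icc in *; lra).
    assert (HD0 : is_derive E t 0).
    { apply (is_derive_ext_loc (fun _ => 0)).
      - assert (Hd : 0 < Rmin (t - t0) (T - t)) by (apply Rmin_pos; lra).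
        exists (mkposreal _ Hd); intros s Hs.
        change (Rabs (s - t) < Rmin (t - t0) (T - t)) in Hs.
        generalize (Rmin_l (t - t0) (T - t)) (Rmin_r (t - t0) (T - t)).
        intros; apply Rabs_lt_between in Hs; symmetry; apply HE.
        unfold Icc; lra.
      - exact (is_derive_const 0 t). }
    assert (HD : is_derive E t _) by (eapply hamiltonian_energy_derive; eauto).
    apply is_derive_unique in HD; apply is_derive_unique in HD0.
    rewrite HD0 in HD; simpl in HD.
    destruct (Hle t Ht') as (? & ? & ? & ?).
    split; apply Rsqr_0_uniq; unfold Rsqr; nra. }
  destruct (continuous_on_Icc_bounded g 0 T) as [K HK];
    [unfold Icc in *; lra | exact Hg |].
  (* With [K] a bound of [g], the factor [exp (- 2 K s)] makes the square of [x2]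
     nonincreasing: uniqueness forward in time from [t0]. *)
  pose (G := fun s => z X2 s * z X2 s * exp (- (2 * K) * s)).
  assert (HG : forall t, Icc 0 T t -> is_derive G t
    ((2 * z X2 t * (z X1 t + g t * z X2 t - q * z Y2 t)
      - 2 * K * z X2 t ^ 2) * exp (- (2 * K) * t))).
  { intros t Ht; assert (Hexp : is_derive (fun s => exp (- (2 * K) * s)) t
      (- (2 * K) * exp (- (2 * K) * t))) by (auto_derive; [trivial | ring]).
    unfold G; derive_with ltac:(first [derive_solution Hz | exact Hexp]).
    simpl; ring. }
  (* At [t0] and [T] the products vanish for other reasons than inside: [x2(t0)]
     is zero, and so are [x1(T)] and [y2(T)]. *)
  assert (Hcross : forall t, Icc t0 T t ->
    z X2 t * z X1 t = 0 /\ z X2 t * z Y2 t = 0).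
  { intros t [Ht Ht'].
    destruct (Req_dec t t0) as [->|N0]; [rewrite H2; lra|].
    destruct (Req_dec t T) as [->|NT]; [rewrite HX1, HY2; lra|].
    destruct (Hvan t) as [-> ->]; lra. }
  assert (HGT : G T <= G t0).
  { eapply derivative_le_0_decreasing with (1 := proj2 Ht0).
    - intros t Ht; apply HG; eauto.
    - intros t Ht; simpl; destruct (Hcross t Ht) as [C1 C2].
      generalize (HK t (Hsub t0 T Ht0 HTT t Ht)) (exp_pos (- (2 * K) * t)).
      generalize (pow2_ge_0 (z X2 t)); intros Hsq Hgt Hexp.
      apply Rabs_le_between in Hgt.
      replace (_ - _) with (2 * (z X2 t * z X1 t) - 2 * q * (z X2 t * z Y2 t)
        + 2 * ((g t - K) * z X2 t ^ 2)) by ring.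
      rewrite C1, C2.
      assert ((g t - K) * z X2 t ^ 2 <= 0) by nra.
      nra. }
  unfold G in HGT; rewrite H2 in HGT.
  generalize (exp_pos (- (2 * K) * T)); intros Hexp.
  apply Rsqr_0_uniq; unfold Rsqr; nra.
Qed.

(** * The Riccati equation *)

Definition riccati_mu p q r (mu eta : R) : R :=
  p * mu ^ 2 + q * eta ^ 2 - 2 * eta - r.
Definition riccati_eta p q g (mu eta rho : R) : R :=
  p * mu * eta + q * rho * eta - rho - g * eta.
Definition riccati_rho p q g w (eta rho : R) : R :=
  p * eta ^ 2 + q * rho ^ 2 - 2 * g * rho - w.

Lemma is_derive_Rdiv (f g : R -> R) (t df dg : R) :
  g t <> 0 -> is_derive f t df -> is_derive g t dg ->
  is_derive (fun s => f s / g s) t ((df * g t - f t * dg) / g t ^ 2).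
Proof. intros; now apply (is_derive_div f g). Qed.

(** [P = Y X^-1], written out by Cramer's rule, where [x] and [u] are the columns
    of the solution starting from the identity and [diag(tv, 0)] at [T]. *)
Lemma riccati_exists p q r T g w tv :
  0 < p -> 0 < q -> 0 < r -> 0 < tv -> 0 <= T ->
  continuous_on_Icc g 0 T -> continuous_on_Icc w 0 T ->
  (forall t, Icc 0 T t -> 0 <= w t) ->
  exists mu eta rho : R -> R, mu T = tv /\ eta T = 0 /\ rho T = 0 /\
    forall t, Icc 0 T t ->
      is_derive mu t (riccati_mu p q r (mu t) (eta t)) /\
      is_derive eta t (riccati_eta p q (g t) (mu t) (eta t) (rho t)) /\
      is_derive rho t (riccati_rho p q (g t) (w t) (eta t) (rho t)).
Proof.
  intros Hp Hq Hr Htv HT Hg Hwc Hw.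
  destruct (hamiltonian_solution_exists p q r T g w
    (fun i => match i with X1 => 1 | X2 => 0 | Y1 => tv | Y2 => 0 end))
    as (x & HxT & Hx); auto.
  destruct (hamiltonian_solution_exists p q r T g w
    (fun i => match i with X1 => 0 | X2 => 1 | Y1 => 0 | Y2 => 0 end))
    as (u & HuT & Hu); auto.
  assert (Hdet : forall t, Icc 0 T t -> x X1 t * u X2 t - u X1 t * x X2 t <> 0).
  { intros t Ht D.
    assert (Hker : forall a b, a * x X1 t + b * u X1 t = 0 ->
      a * x X2 t + b * u X2 t = 0 -> a = 0 /\ b = 0).
    { intros a b E1 E2.
      destruct (hamiltonian_position_nonvanishing p q r T g w tv
        (fun i t => a * x i t + b * u i t) t) as [K1 K2]; auto.
      - now apply hamiltonian_solution_lincomb.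
      - rewrite !HxT, !HuT; ring.
      - rewrite !HxT, !HuT; ring.
      - rewrite !HxT, !HuT in K1, K2; lra. }
    (* The columns of the adjugate matrix are in the kernel, so the matrix is zero,
       and then every vector is in the kernel. *)
    destruct (Hker (u X1 t) (- x X1 t)) as [A1 A2]; [ring | lra |].
    destruct (Hker (u X2 t) (- x X2 t)) as [A3 A4]; [lra | ring |].
    destruct (Hker 1 0) as [A5 _]; lra. }
  (* The symplectic form of the two columns is constant and zero at [T]: this is
     the symmetry of [Y X^-1]. *)
  assert (Hsym : forall t, Icc 0 T t ->
    x X1 t * u Y1 t + x X2 t * u Y2 t - x Y1 t * u X1 t - x Y2 t * u X2 t = 0).
  { intros t Ht.
    enough (H : Rabs (x X1 t * u Y1 t + x X2 t * u Y2 t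
      - x Y1 t * u X1 t - x Y2 t * u X2 t) <= 0).
    { apply Rabs_le_between in H; lra. }
    apply (derivative_comparison
      (fun t => x X1 t * u Y1 t + x X2 t * u Y2 t
        - x Y1 t * u X1 t - x Y2 t * u X2 t)
      (fun _ => 0) (fun _ => 0) (fun _ => 0) t T (proj2 Ht)).
    - intros s Hs; assert (Hs' : Icc 0 T s) by (unfold Icc in *; lra).
      derive_with ltac:(first [derive_solution Hx | derive_solution Hu]).
      simpl; ring.
    - intros s _; exact (is_derive_const 0 s).
    - intros s _; rewrite Rabs_R0; lra.
    - rewrite !HxT, !HuT.
      replace (_ - _) with 0 by ring; rewrite Rabs_R0; lra. }
  pose (D := fun t => x X1 t * u X2 t - u X1 t * x X2 t).
  exists (fun t => (x Y1 t * u X2 t - u Y1 t * x X2 t) / D t).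
  exists (fun t => (u Y1 t * x X1 t - x Y1 t * u X1 t) / D t).
  exists (fun t => (u Y2 t * x X1 t - x Y2 t * u X1 t) / D t).
  repeat (split; [unfold D; rewrite !HxT, !HuT; field; lra |]).
  intros t Ht.
  assert (HD := Hdet t Ht); fold (D t) in HD.
  assert (Heta : (u Y1 t * x X1 t - x Y1 t * u X1 t) / D t
    = (x Y2 t * u X2 t - u Y2 t * x X2 t) / D t).
  { apply Rmult_eq_reg_r with (D t); [|exact HD].
    unfold Rdiv; rewrite !Rmult_assoc, Rinv_l by exact HD.
    specialize (Hsym t Ht); lra. }
  cbv beta; set (eta := (u Y1 t * x X1 t - x Y1 t * u X1 t) / D t) in *.
  split; [|split]; (eapply is_derive_eq;
    [ apply is_derive_Rdiv; [exact HD| |]; unfold D;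
      repeat derive_step ltac:(first [derive_solution Hx | derive_solution Hu]) | ]).
  (* The quotient rule produces the product of the two off-diagonal entries, and
     their sum, where the equations have the square and the double of [eta]. *)
  - unfold riccati_mu.
    transitivity (p * ((x Y1 t * u X2 t - u Y1 t * x X2 t) / D t) ^ 2
      + q * eta * ((x Y2 t * u X2 t - u Y2 t * x X2 t) / D t)
      - eta - (x Y2 t * u X2 t - u Y2 t * x X2 t) / D t - r);
      [| rewrite <- Heta; ring].
    unfold eta; simpl; unfold D in *; field; exact HD.
  - unfold riccati_eta, eta; simpl; unfold D in *; field; exact HD.
  - unfold riccati_rho.
    replace (eta ^ 2) with (eta * ((x Y2 t * u X2 t - u Y2 t * x X2 t) / D t))
      by (rewrite <- Heta; ring).
    unfold eta; simpl; unfold D in *; field; exact HD.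
Qed.

(** * The full system *)

(** Indexing the unknowns lets the linear theory treat the six equations at once. *)
Inductive unknown := Mu | Eta | Rho | Gamma | Theta | Xi.

Definition tvp_field (r_a r_b r_v sigma_B sigma_W lambda fc fd vb : R)
    (u : unknown -> R) (i : unknown) : R :=
  match i with
  | Mu => 1 / r_a * u Mu ^ 2 + 1 / r_b * u Eta ^ 2 - 2 * u Eta - r_v
  | Eta => 1 / r_a * u Mu * u Eta + 1 / r_b * u Rho * u Eta - u Rho
      - lambda / (r_b * sigma_W ^ 2) * u Eta * fc
  | Rho => 1 / r_a * u Eta ^ 2 + 1 / r_b * u Rho ^ 2
      - 2 * lambda / (r_b * sigma_W ^ 2) * u Rho * fc
      + (lambda ^ 2 / (r_b * sigma_W ^ 4) - lambda / sigma_W ^ 2) * fc ^ 2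
  | Gamma => 1 / r_a * u Mu * u Gamma + 1 / r_b * u Eta * u Theta - u Theta
      + r_v * vb - lambda / (r_b * sigma_W ^ 2) * u Eta * fd
  | Theta => 1 / r_a * u Eta * u Gamma + 1 / r_b * u Rho * u Theta
      - lambda / (r_b * sigma_W ^ 2) * u Theta * fc
      - lambda / (r_b * sigma_W ^ 2) * fd * u Rho
      + (lambda ^ 2 / (r_b * sigma_W ^ 4) - lambda / sigma_W ^ 2) * fc * fd
  | Xi => 1 / (2 * r_a) * u Gamma ^ 2 + 1 / (2 * r_b) * u Theta ^ 2
      - 1 / 2 * sigma_B ^ 2 * u Mu - 1 / 2 * sigma_W ^ 2 * u Rho
      - lambda / (r_b * sigma_W ^ 2) * fd * u Theta
      - r_v / 2 * vb ^ 2
      + (lambda ^ 2 / (2 * r_b * sigma_W ^ 4) - lambda / (2 * sigma_W ^ 2))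
        * fd ^ 2
  end.

Definition unknown_family (mu eta rho gamma theta xi : R -> R) (i : unknown) :
    R -> R :=
  match i with
  | Mu => mu | Eta => eta | Rho => rho
  | Gamma => gamma | Theta => theta | Xi => xi
  end.

Definition tvp_terminal (t_v vbar_T : R) (i : unknown) : R :=
  match i with
  | Mu => t_v | Gamma => - t_v * vbar_T | Xi => t_v / 2 * vbar_T ^ 2
  | _ => 0
  end.

Lemma tvp_solution_family r_a r_b r_v t_v sigma_B sigma_W vbar_T lambda T
    f_c f_d vbar mu eta rho gamma theta xi :
  let y := unknown_family mu eta rho gamma theta xi in
  tvp_solution r_a r_b r_v t_v sigma_B sigma_W vbar_T lambda T f_c f_d vbar
    mu eta rho gamma theta xi <->
  (forall i, has_deriv_on_Icc (y i)
     (fun t => tvp_field r_a r_b r_v sigma_B sigma_W lambda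
                 (f_c t) (f_d t) (vbar t) (fun j => y j t) i) 0 T) /\
  (forall i, y i T = tvp_terminal t_v vbar_T i).
Proof.
  intros y; split.
  - intros [(? & ? & ? & ? & ? & ?) (? & ? & ? & ? & ? & ?)].
    split; intros []; assumption.
  - intros [Hd HT]; split.
    + exact (conj (Hd Mu) (conj (Hd Eta) (conj (Hd Rho)
        (conj (Hd Gamma) (conj (Hd Theta) (Hd Xi)))))).
    + exact (conj (HT Mu) (conj (HT Eta) (conj (HT Rho)
        (conj (HT Gamma) (conj (HT Theta) (HT Xi)))))).
Qed.

(** A difference of products is [a b - a' b' = a (b - b') + b' (a - a')], so the
    difference of two solutions solves a homogeneous linear system, whose
    coefficients are continuous because [y], [z], [f_c] and [f_d] are. *)
Lemma tvp_unique r_a r_b r_v sigma_B sigma_W lambda T f_c f_d vbar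
    (y z : unknown -> R -> R) :
  r_a <> 0 -> r_b <> 0 -> sigma_W <> 0 ->
  continuous_on_Icc f_c 0 T -> continuous_on_Icc f_d 0 T ->
  (forall i t, Icc 0 T t -> is_derive (y i) t
     (tvp_field r_a r_b r_v sigma_B sigma_W lambda
        (f_c t) (f_d t) (vbar t) (fun j => y j t) i)) ->
  (forall i t, Icc 0 T t -> is_derive (z i) t
     (tvp_field r_a r_b r_v sigma_B sigma_W lambda
        (f_c t) (f_d t) (vbar t) (fun j => z j t) i)) ->
  (forall i, y i T = z i T) ->
  forall i t, Icc 0 T t -> y i t = z i t.
Proof.
  intros Ha Hb Hs Hfc Hfd Hy Hz HT i t Ht.
  assert (Hyc : forall i, continuous_on_Icc (y i) 0 T)
    by (intros j; eapply continuous_on_Icc_derive, Hy).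
  assert (Hzc : forall i, continuous_on_Icc (z i) 0 T)
    by (intros j; eapply continuous_on_Icc_derive, Hz).
  enough (E : y i t - z i t = 0) by lra.
  pose (k := lambda / (r_b * sigma_W ^ 2)).
  pose (A := fun i j t => match i, j with
    | Mu, Mu => 1 / r_a * (y Mu t + z Mu t)
    | Mu, Eta => 1 / r_b * (y Eta t + z Eta t) - 2
    | Eta, Mu => 1 / r_a * z Eta t
    | Eta, Eta => 1 / r_a * y Mu t + 1 / r_b * y Rho t - k * f_c t
    | Eta, Rho => 1 / r_b * z Eta t - 1
    | Rho, Eta => 1 / r_a * (y Eta t + z Eta t)
    | Rho, Rho => 1 / r_b * (y Rho t + z Rho t) - 2 * k * f_c t
    | Gamma, Mu => 1 / r_a * z Gamma t
    | Gamma, Eta => 1 / r_b * z Theta t - k * f_d t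
    | Gamma, Gamma => 1 / r_a * y Mu t
    | Gamma, Theta => 1 / r_b * y Eta t - 1
    | Theta, Eta => 1 / r_a * z Gamma t
    | Theta, Rho => 1 / r_b * z Theta t - k * f_d t
    | Theta, Gamma => 1 / r_a * y Eta t
    | Theta, Theta => 1 / r_b * y Rho t - k * f_c t
    | Xi, Mu => - (1 / 2 * sigma_B ^ 2)
    | Xi, Rho => - (1 / 2 * sigma_W ^ 2)
    | Xi, Gamma => 1 / (2 * r_a) * (y Gamma t + z Gamma t)
    | Xi, Theta => 1 / (2 * r_b) * (y Theta t + z Theta t) - k * f_d t
    | _, _ => 0
    end).
  apply (linear_homogeneous_zero unknown [Mu; Eta; Rho; Gamma; Theta; Xi] A
    (fun i t => y i t - z i t) 0 T).
  - intros []; simpl; tauto.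
  - intros [] []; unfold A; continuity_on; auto.
  - intros j s Hjs; eapply is_derive_eq.
    + apply is_derive_Rminus; [apply Hy | apply Hz]; exact Hjs.
    + destruct j; simpl; unfold k; field; auto.
  - intros j; rewrite HT; ring.
  - exact Ht.
Qed.

Theorem theorem2 (r_a r_b r_v t_v sigma_B sigma_W vbar_T lambda : R)
    (hra : 0 < r_a) (hrb : 0 < r_b) (hrv : 0 < r_v) (htv : 0 < t_v)
    (hsB : 0 < sigma_B) (hsW : 0 < sigma_W)
    (hlambda : 0 <= lambda <= r_b * sigma_W ^ 2)
    (T : R) (hT : 0 < T) (f_c f_d vbar : R -> R)
    (hfc : continuous_on_Icc f_c 0 T) (hfd : continuous_on_Icc f_d 0 T)
    (hvbar : continuous_on_Icc vbar 0 T) :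
  exists mu eta rho gamma theta xi : R -> R,
    tvp_solution r_a r_b r_v t_v sigma_B sigma_W vbar_T lambda T f_c f_d vbar
      mu eta rho gamma theta xi
    /\ (forall mu' eta' rho' gamma' theta' xi' : R -> R,
          tvp_solution r_a r_b r_v t_v sigma_B sigma_W vbar_T lambda T
            f_c f_d vbar mu' eta' rho' gamma' theta' xi' ->
          eq_on_Icc mu' mu 0 T /\ eq_on_Icc eta' eta 0 T
          /\ eq_on_Icc rho' rho 0 T /\ eq_on_Icc gamma' gamma 0 T
          /\ eq_on_Icc theta' theta 0 T /\ eq_on_Icc xi' xi 0 T).
Proof.
  pose (k := lambda / (r_b * sigma_W ^ 2)).
  pose (c := lambda / sigma_W ^ 2 - lambda ^ 2 / (r_b * sigma_W ^ 4)).
  assert (Hc : 0 <= c).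
  { replace c with (lambda * (r_b * sigma_W ^ 2 - lambda) / (r_b * sigma_W ^ 4))
      by (unfold c; field; lra).
    apply Rdiv_le_0_compat; [apply Rmult_le_pos; lra|].
    apply Rmult_lt_0_compat; [exact hrb | now apply pow_lt]. }
  destruct (riccati_exists (1 / r_a) (1 / r_b) r_v T (fun t => k * f_c t)
    (fun t => c * f_c t ^ 2) t_v) as (mu & eta & rho & Hmu & Heta & Hrho & Hd);
    try (apply Rdiv_lt_0_compat); try lra.
  { continuity_on. }
  { continuity_on. }
  { intros t _; apply Rmult_le_pos; [exact Hc | apply pow2_ge_0]. }
  assert (Hmuc : continuous_on_Icc mu 0 T)
    by (eapply continuous_on_Icc_derive; intros t Ht; apply Hd, Ht).
  assert (Hetac : continuous_on_Icc eta 0 T)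
    by (eapply continuous_on_Icc_derive; intros t Ht; apply Hd, Ht).
  assert (Hrhoc : continuous_on_Icc rho 0 T)
    by (eapply continuous_on_Icc_derive; intros t Ht; apply Hd, Ht).
  destruct (linear_terminal_value_problem bool [true; false]
    (fun i j t => match i, j with
      | true, true => 1 / r_a * mu t
      | true, false => 1 / r_b * eta t - 1
      | false, true => 1 / r_a * eta t
      | false, false => 1 / r_b * rho t - k * f_c t
      end)
    (fun (i : bool) t => if i
      then r_v * vbar t - k * eta t * f_d t
      else - (k * f_d t * rho t) - c * f_c t * f_d t)
    (fun i : bool => if i then - t_v * vbar_T else 0) 0 T)
    as (gt & HgtT & Hgt).
  { intros []; simpl; tauto. }
  { lra. }
  { intros [] []; continuity_on. }
  { intros []; continuity_on. }
  assert (Hgtc : forall i, continuous_on_Icc (gt i) 0 T)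
    by (intros i; eapply continuous_on_Icc_derive, Hgt).
  destruct (linear_terminal_value_problem unit [tt]
    (fun _ _ _ => 0)
    (fun _ t => 1 / (2 * r_a) * gt true t ^ 2 + 1 / (2 * r_b) * gt false t ^ 2
      - 1 / 2 * sigma_B ^ 2 * mu t - 1 / 2 * sigma_W ^ 2 * rho t
      - k * f_d t * gt false t - r_v / 2 * vbar t ^ 2 - c / 2 * f_d t ^ 2)
    (fun _ => t_v / 2 * vbar_T ^ 2) 0 T) as (xi & HxiT & Hxi).
  { intros []; simpl; tauto. }
  { lra. }
  { intros; continuity_on. }
  { intros; continuity_on; apply Hgtc. }
  pose (z := unknown_family mu eta rho (gt true) (gt false) (xi tt)).
  assert (Hz : forall i t, Icc 0 T t -> is_derive (z i) t
    (tvp_field r_a r_b r_v sigma_B sigma_W lambda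
       (f_c t) (f_d t) (vbar t) (fun j => z j t) i)).
  { intros i t Ht; destruct (Hd t Ht) as (H1 & H2 & H3).
    generalize (Hgt true t Ht) (Hgt false t Ht) (Hxi tt t Ht); intros H4 H5 H6.
    destruct i; (eapply is_derive_eq; [eassumption|]);
      unfold riccati_mu, riccati_eta, riccati_rho, k, c; simpl; field; lra. }
  assert (HzT : forall i, z i T = tvp_terminal t_v vbar_T i).
  { exact (unknown_ind _ Hmu Heta Hrho (HgtT true) (HgtT false) (HxiT tt)). }
  exists mu, eta, rho, (gt true), (gt false), (xi tt); split.
  - apply tvp_solution_family; split; [|exact HzT].
    intros i; apply has_deriv_on_Icc_of_is_derive, Hz.
  - intros mu' eta' rho' gamma' theta' xi' Hsol.
    apply tvp_solution_family in Hsol; destruct Hsol as [Hy HyT].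
    set (y := unknown_family mu' eta' rho' gamma' theta' xi') in *.
    enough (H : forall i, eq_on_Icc (y i) (z i) 0 T)
      by exact (conj (H Mu) (conj (H Eta) (conj (H Rho)
        (conj (H Gamma) (conj (H Theta) (H Xi)))))).
    assert (Hext : forall i, exists g, eq_on_Icc (y i) g 0 T /\
      forall t, Icc 0 T t -> is_derive g t
        (tvp_field r_a r_b r_v sigma_B sigma_W lambda
           (f_c t) (f_d t) (vbar t) (fun j => y j t) i))
      by (intros i; now apply has_deriv_on_Icc_extend).
    destruct (Hext Mu) as (g1 & ? & ?), (Hext Eta) as (g2 & ? & ?),
      (Hext Rho) as (g3 & ? & ?), (Hext Gamma) as (g4 & ? & ?),
      (Hext Theta) as (g5 & ? & ?), (Hext Xi) as (g6 & ? & ?).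
    pose (g := unknown_family g1 g2 g3 g4 g5 g6).
    assert (Hyg : forall i, eq_on_Icc (y i) (g i) 0 T) by (intros []; assumption).
    assert (Hg : forall i t, Icc 0 T t -> is_derive (g i) t
      (tvp_field r_a r_b r_v sigma_B sigma_W lambda
         (f_c t) (f_d t) (vbar t) (fun j => g j t) i)).
    { intros i t Ht; eapply is_derive_eq.
      - instantiate (1 := tvp_field r_a r_b r_v sigma_B sigma_W lambda
           (f_c t) (f_d t) (vbar t) (fun j => y j t) i).
        destruct i; auto.
      - assert (E : forall j, y j t = g j t) by (intros j; now apply Hyg).
        destruct i; cbn [tvp_field]; now rewrite !E. }
    intros i t Ht; rewrite (Hyg i t Ht).
    apply (tvp_unique r_a r_b r_v sigma_B sigma_W lambda T f_c f_d vbar g z);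
      try assumption; try lra.
    intros j; rewrite <- Hyg by (unfold Icc; lra); now rewrite HyT, HzT.
Qed.
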